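(* Let $k$ be a field, $S=k[x_1,\dots,x_n]$, let $B\subset S$ be an ideal generated by square-free monomials, and let $i\ge 0$. If $p,q\in\mathbf{Z}^n$ satisfy $\mathrm{neg}(p)=\mathrm{neg}(q)$, then there is a canonical isomorphism (of $k$-vector spaces) $$H^i_B(S)_p\;\cong\;H^i_B(S)_q .$$
   Context: $S$ carries its fine $\mathbf{Z}^n$-grading ($\deg x_j=e_j$). Since $B$ is a monomial ideal, the local cohomology module $H^i_B(S)$ (the $i$-th local cohomology of $S$ with supports in $B$) is naturally $\mathbf{Z}^n$-graded, and $H^i_B(S)_p$ denotes its component of degree $p$. For $p\in\mathbf{Z}^n$, $\mathrm{neg}(p)=\{j\in\{1,\dots,n\}\mid p_j<0\}$. *)

(* Defs.v *)
From HB Require Import structures.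
From mathcomp Require Import all_boot all_order all_algebra.
From mathcomp Require Import generic_quotient ring_quotient.
From mathcomp Require Import boolp classical_sets functions.
From mathcomp Require Import mpoly.

Set Implicit Arguments.
Unset Strict Implicit.
Unset Printing Implicit Defensive.

Import Order.TTheory GRing.Theory Num.Theory.
Local Open Scope classical_set_scope.
Local Open Scope quotient_scope.
Local Open Scope ring_scope.

Section Subquotients.
Variables (R : pzRingType) (V : lmodType R).

Definition submod (Z : submodClosed V) : Type := {u : V | u \in Z}.

HB.instance Definition _ (Z : submodClosed V) := SubChoice.on (submod Z).
HB.instance Definition _ (Z : submodClosed V) :=
  [SubChoice_isSubLmodule of submod Z by <:].

(* submodClosed is stated over semirings, so closure under opposite has to be
   derived before Quotient.quot applies. *)
Definition submod_zmod (W : submodClosed V) : {pred V} := fun u => u \in W.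

Lemma submod_zmod_closed (W : submodClosed V) : zmod_closed (submod_zmod W).
Proof. exact: GRing.subsemimod_closedB (GRing.subsemimodClosedP W). Qed.

HB.instance Definition _ (W : submodClosed V) :=
  GRing.isZmodClosed.Build V (submod_zmod W) (submod_zmod_closed W).

Definition quotmod (W : submodClosed V) : Type := @Quotient.quot V (submod_zmod W).

HB.instance Definition _ (W : submodClosed V) := GRing.Zmodule.on (quotmod W).

Definition quotmod_pi (W : submodClosed V) (u : V) : quotmod W :=
  \pi_(@Quotient.quot V (submod_zmod W)) u.

Section QuotMod.
Variable W : submodClosed V.
Local Notation pi := (@quotmod_pi W).

Lemma quotmod_piE u v : (pi u = pi v) <-> (u - v \in W).
Proof.
rewrite -[u - v \in W]/(u - v \in submod_zmod W) Quotient.idealrBE.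
by split=> [E|/eqP]; first exact/eqP.
Qed.

Lemma quotmod_reprK (h : quotmod W) : pi (repr h) = h.
Proof. exact: reprK. Qed.

Lemma quotmod_piD u v : pi (u + v) = pi u + pi v.
Proof. exact: raddfD. Qed.

Definition quotmod_scale (a : R) (h : quotmod W) : quotmod W := pi (a *: repr h).

Lemma quotmod_scale_pi a u : quotmod_scale a (pi u) = pi (a *: u).
Proof.
apply/quotmod_piE; rewrite -scalerBr; apply: rpredZ.
by apply/quotmod_piE; rewrite quotmod_reprK.
Qed.

Lemma quotmod_scaleA a b h :
  quotmod_scale a (quotmod_scale b h) = quotmod_scale (a * b) h.
Proof. by rewrite -[h]quotmod_reprK !quotmod_scale_pi scalerA. Qed.

Lemma quotmod_scale1 : left_id 1 quotmod_scale.
Proof. by move=> h; rewrite -[h]quotmod_reprK quotmod_scale_pi scale1r. Qed.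

Lemma quotmod_scaleDr : right_distributive quotmod_scale +%R.
Proof.
move=> a g h; rewrite -[g]quotmod_reprK -[h]quotmod_reprK -quotmod_piD.
by rewrite !quotmod_scale_pi scalerDr quotmod_piD.
Qed.

Lemma quotmod_scaleDl h :
  {morph (fun a => quotmod_scale a h) : a b / a + b}.
Proof.
move=> a b; rewrite -[h]quotmod_reprK !quotmod_scale_pi scalerDl.
exact: quotmod_piD.
Qed.

HB.instance Definition _ := GRing.Zmodule_isLmodule.Build R (quotmod W)
  quotmod_scaleA quotmod_scale1 quotmod_scaleDr quotmod_scaleDl.

End QuotMod.
End Subquotients.

Section Ideals.
Variable R : comNzRingType.

Definition ideal_generated (A : set R) : set R :=
  [set f | exists s : seq (R * R),
     (forall ag, ag \in s -> A ag.2) /\ f = \sum_(ag <- s) ag.1 * ag.2].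

Definition ideal_power (B : set R) (d : nat) : set R :=
  ideal_generated
    [set f | exists t : 'I_d -> R, (forall i, B (t i)) /\ f = \prod_(i < d) t i].

Lemma ideal_power_add (B : set R) d e :
  ideal_power B (d + e) `<=` ideal_power B d `&` ideal_power B e.
Proof.
move=> f [s [sP ->]].
have H d1 (proj : forall t : 'I_(d + e) -> R, (forall i, B (t i)) ->
    exists t1 : 'I_d1 -> R, (forall i, B (t1 i)) /\
      exists c, \prod_(i < d + e) t i = c * \prod_(i < d1) t1 i) :
    ideal_power B d1 (\sum_(ag <- s) ag.1 * ag.2).
  elim: s sP => [|[a g] s IHs] sP; first by exists [::]; rewrite !big_nil.
  have [|s1 [s1P Es]] := IHs; first by move=> ag ags; apply: sP; rewrite inE ags orbT.
  have [t [tB /= ->]] := sP (a, g) (mem_head _ _).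
  have [t1 [t1B [c E]]] := proj t tB.
  exists ((a * c, \prod_(i < d1) t1 i) :: s1); split.
    by move=> ag; rewrite inE => /predU1P[->|/s1P//]; exists t1.
  by rewrite !big_cons /= Es E mulrA.
split; apply: H => t tB.
  exists (fun i => t (lshift e i)); split=> //.
  by exists (\prod_(i < e) t (rshift d i)); rewrite big_split_ord mulrC.
exists (fun i => t (rshift d i)); split=> //.
by exists (\prod_(i < d) t (lshift e i)); rewrite big_split_ord.
Qed.

End Ideals.

Section FineGrading.
Variables (k : fieldType) (n : nat).
Local Notation S := {mpoly k[n]}.
Local Notation degree := 'rV[int]_n.

Definition neg (p : degree) : {set 'I_n} := [set j | p 0 j < 0]%SET.

Definition mnm_degree (m : 'X_{1..n}) : degree := \row_j (m j)%:Z.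

Lemma mnm_degree_inj : injective mnm_degree.
Proof.
by move=> m1 m2 /rowP E; apply/mnmP => j; have := E j; rewrite !mxE => -[].
Qed.

Definition homogeneous (p : degree) : set S :=
  [set f | forall m, m \in msupp f -> mnm_degree m = p].

(* M is the direct sum of the subgroups gr p, and S_a M_p is contained in
   M_(a + p); the choice a = 0 makes every gr p a k-subspace. *)
Record gradedModule := GradedModule {
  gr_sort :> lmodType S;
  gr : degree -> set gr_sort;
  gr0 : forall p, gr p 0;
  grD : forall p u v, gr p u -> gr p v -> gr p (u + v);
  grM : forall a p f u, homogeneous a f -> gr p u -> gr (a + p) (f *: u);
  gr_span : forall u, exists (s : seq degree) (f : degree -> gr_sort),
    (forall p, gr p (f p)) /\ u = \sum_(p <- s) f p;
  gr_direct : forall (s : seq degree) (f : degree -> gr_sort), uniq s ->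
    (forall p, gr p (f p)) -> \sum_(p <- s) f p = 0 ->
    forall p, p \in s -> f p = 0
}.

Lemma homogeneous0 p : homogeneous p 0.
Proof. by move=> m; rewrite msupp0. Qed.

Lemma homogeneousD p f g :
  homogeneous p f -> homogeneous p g -> homogeneous p (f + g).
Proof.
move=> hf hg m /msuppD_le; rewrite mem_cat => /orP[/hf|/hg]; exact.
Qed.

Lemma homogeneousM a p f g :
  homogeneous a f -> homogeneous p g -> homogeneous (a + p) (f * g).
Proof.
move=> hf hg m /msuppM_le /allpairsP[[m1 m2] /= [/hf <- /hg <- ->]].
by apply/rowP => j; rewrite !mxE mnmDE PoszD.
Qed.

Lemma homogeneous_span (f : S) : exists (s : seq degree) (g : degree -> S),
  (forall p, homogeneous p (g p)) /\ f = \sum_(p <- s) g p.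
Proof.
exists [seq mnm_degree m | m <- msupp f].
exists (fun p => \sum_(m <- msupp f | mnm_degree m == p) f@_m *: 'X_[m]); split.
  move=> p; elim/big_ind: _ => [||m /eqP <- m1].
  - exact: homogeneous0.
  - exact: homogeneousD.
  by move=> /msuppZ_le; rewrite msuppX inE => /eqP->.
rewrite big_map {1}[f]mpolyE [LHS]big_seq [RHS]big_seq; apply: eq_bigr => m mf.
rewrite -big_filter (@eq_filter _ _ (pred1 m)); last first.
  by move=> m1 /=; rewrite (inj_eq mnm_degree_inj).
by rewrite filter_pred1_uniq ?msupp_uniq // big_seq1.
Qed.

Lemma homogeneous_direct (s : seq degree) (g : degree -> S) : uniq s ->
  (forall p, homogeneous p (g p)) -> \sum_(p <- s) g p = 0 ->
  forall p, p \in s -> g p = 0.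
Proof.
move=> us hg E p ps; apply/mpolyP => m; rewrite mcoeff0.
have [mp|] := boolP (m \in msupp (g p)); last by move/memN_msupp_eq0.
have := congr1 (mcoeff m) E; rewrite mcoeff0 (bigD1_seq p) //= raddfD raddf_sum /=.
rewrite big1 ?addr0 // => q qp; apply: memN_msupp_eq0; apply: contra qp.
by move=> /hg <-; apply/eqP; exact: hg.
Qed.

Definition polynomialModule : gradedModule :=
  @GradedModule (S^o : lmodType S) homogeneous homogeneous0 homogeneousD
    homogeneousM homogeneous_span homogeneous_direct.

Definition degree_preserving (M N : gradedModule) (f : M -> N) : Prop :=
  forall p, gr p `<=` f @^-1` gr p.

Definition graded_injective (E : gradedModule) : Prop :=
  forall (M N : gradedModule) (j : {linear M -> N}) (f : {linear M -> E}),
    degree_preserving j -> degree_preserving f -> injective j ->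
    exists g : {linear N -> E},
      degree_preserving g /\ forall u, g (j u) = f u.

(* Resolutions are taken in the category of Z^n-graded modules: this computes the
   same local cohomology as ungraded injective resolutions and gives it its
   natural Z^n-grading. *)
Record injectiveResolution (M : gradedModule) := InjectiveResolution {
  term :> nat -> gradedModule;
  aug : {linear M -> term 0%N};
  diff : forall i, {linear term i -> term i.+1};
  aug_degree : degree_preserving aug;
  diff_degree : forall i, degree_preserving (@diff i);
  term_injective : forall i, graded_injective (term i);
  aug_injective : injective aug;
  aug_exact : forall u, @diff 0%N u = 0 <-> exists v, aug v = u;
  diff_exact : forall i u, @diff i.+1 u = 0 <-> exists v, @diff i v = u
}.

Definition squarefree_monomial_ideal (B : set S) : Prop :=
  exists G : set 'X_{1..n},
    (forall m, G m -> forall j, (m j <= 1)%N) /\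
    B = ideal_generated [set 'X_[m] | m in G].

Section Cohomology.
Variable B : set S.

(* Gamma_B(M), the elements killed by some power of B. *)
Definition torsion (M : gradedModule) : {pred M} :=
  fun u => `[< exists d, forall f, ideal_power B d f -> f *: u = 0 >].

Lemma torsion_submod M : subsemimod_closed (@torsion M).
Proof.
split; [split|].
- by apply/asboolP; exists 0%N => f _; rewrite scaler0.
- move=> u v /asboolP[d du] /asboolP[e ev]; apply/asboolP; exists (d + e)%N.
  by move=> f /ideal_power_add[df ef]; rewrite scalerDr du ?ev ?addr0.
move=> a u /asboolP[d du]; apply/asboolP; exists d => f df.
by rewrite scalerA mulrC -scalerA du ?scaler0.
Qed.

HB.instance Definition _ (M : gradedModule) :=
  GRing.isSubmodClosed.Build S M (@torsion M) (torsion_submod M).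

Variables (M : gradedModule) (I : injectiveResolution M).

Definition cocycle (i : nat) : {pred I i} :=
  fun u => (u \in @torsion (I i)) && (diff I i u == 0).

Lemma cocycle_submod i : subsemimod_closed (@cocycle i).
Proof.
split; [split|].
- by rewrite unfold_in rpred0 linear0 eqxx.
- move=> u v /andP[uT /eqP du] /andP[vT /eqP dv].
  by apply/andP; rewrite rpredD // linearD du dv addr0.
by move=> a u /andP[uT /eqP du]; apply/andP; rewrite rpredZ // linearZ /= du scaler0.
Qed.

HB.instance Definition _ i :=
  GRing.isSubmodClosed.Build S (I i) (@cocycle i) (cocycle_submod i).

Definition boundary (i : nat) : set (I i) :=
  match i with
  | 0 => [set 0]
  | j.+1 => [set diff I j v | v in [set v | v \in @torsion (I j)]]
  end.

Definition coboundary (i : nat) : {pred submod (@cocycle i)} :=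
  fun z => `[< boundary (val z) >].

Lemma coboundary_submod i : subsemimod_closed (@coboundary i).
Proof.
case: i => [|i]; (split; [split|]).
- exact/asboolP.
- by move=> u v /asboolP/= u0 /asboolP/= v0; apply/asboolP; rewrite /= u0 v0 addr0.
- by move=> a u /asboolP/= u0; apply/asboolP; rewrite /= u0 scaler0.
- by apply/asboolP; exists 0; rewrite ?linear0 //= rpred0.
- move=> u v /asboolP[u1 /= Tu Eu] /asboolP[v1 /= Tv Ev]; apply/asboolP.
  by exists (u1 + v1); rewrite /= ?rpredD // linearD Eu Ev.
move=> a u /asboolP[u1 /= Tu Eu]; apply/asboolP.
by exists (a *: u1); rewrite /= ?rpredZ // linearZ Eu.
Qed.

HB.instance Definition _ i := GRing.isSubmodClosed.Build S
  (submod (@cocycle i)) (@coboundary i) (coboundary_submod i).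

Definition localCohomology (i : nat) : lmodType S := quotmod (@coboundary i).

(* The classes of the cocycles of degree p. *)
Definition localCohomology_gr (i : nat) (p : degree) : set (localCohomology i) :=
  [set quotmod_pi (@coboundary i) z | z in [set z | gr p (val z)]].

End Cohomology.

Definition k_linear_on (U V : lmodType S) (A : set U) (f : U -> V) : Prop :=
  forall (c : k) u v, A u -> A v ->
    f (c%:MP *: u + v) = c%:MP *: f u + f v.

Definition k_isomorphism (U V : lmodType S) (A : set U) (A' : set V)
    (f : U -> V) : Prop :=
  set_bij A A' f /\ k_linear_on A f.

(* "f is multiplication by x^(q - p)", with denominators cleared: it makes sense
   for arbitrary p and q, and for p <= q (take b = 0) it literally says so. *)
Definition monomial_shift (H : lmodType S) (Hgr : degree -> set H)
    (p q : degree) (f : H -> H) : Prop :=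
  set_fun (Hgr p) (Hgr q) f /\
  forall (a b : 'X_{1..n}) u, p + mnm_degree a = q + mnm_degree b -> Hgr p u ->
    'X_[a] *: u = 'X_[b] *: f u.

End FineGrading.

Arguments torsion {k n} B M _ : rename.
Arguments cocycle {k n} B {M} I i _ : rename.
Arguments boundary {k n} B {M} I i _ : rename.
Arguments coboundary {k n} B {M} I i _ : rename.
Arguments localCohomology {k n} B {M} I i.
Arguments localCohomology_gr {k n} B {M} I i p _ : rename.

(* Main.v *)
Require Import Defs.
From HB Require Import structures.
From mathcomp Require Import all_boot all_order all_algebra.
From mathcomp Require Import boolp classical_sets functions.
From mathcomp Require Import mpoly.
From mathcomp Require Import zify.

Set Implicit Arguments.
Unset Strict Implicit.
Unset Printing Implicit Defensive.

Import Order.TTheory GRing.Theory Num.Theory.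
Local Open Scope classical_set_scope.
Local Open Scope ring_scope.

(** Multiplication by a monomial [x^(q - p)] with [p <= q] and [neg p = neg q]
is shown to be a bijection [H_p -> H_q] on local cohomology.  For general [p]
and [q] with the same negative support, monomials carry both [H_p] and [H_q]
isomorphically onto [H_s], where [s] is the entrywise maximum and has the same
negative support; the isomorphism is the only map compatible with these two
multiplications.

A Z^n-graded module is a diagram of vector spaces indexed by the poset Z^n, so
it can be pulled back along a monotone map [phi : Z^n -> Z^n]: the component of
[phi^* M] in degree [r] is [M_(phi r)].  This operation is exact.  The map used
here, [collapse p q], sends, in each coordinate, the interval from [p_j] to
[q_j] to [q_j] and fixes the other integers.  Three properties matter.
 - [r <= phi r], so multiplication by [x^(phi r - r)] is a natural linear map
   [eta : M -> phi^* M].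
 - [phi p = phi q = q], so in [phi^* M] multiplication by [x^(q - p)] from
   degree [p] to degree [q] is the identity of [M_q].
 - When [neg p = neg q], [phi r >= 0] forces [r >= 0], so [eta] is an
   isomorphism for [M = S] ([unit_polynomial_inj], [unit_polynomial_surj]).

Let [I] be an injective resolution of [S].  By exactness [phi^* I] is a
resolution of [phi^* S], hence of [S], and injectivity of the terms of [I]
gives a chain map [b : phi^* I -> I] under [S] ([comparison_exists]).  The
composite [b eta] is an endomorphism of [I] under [S], so it is homotopic to
the identity ([retraction_homotopic]).  The chain map and the homotopy are
linear, so they respect torsion, and on cohomology [b eta] is the identity.

In degree [p], [eta] is multiplication by [x^(q - p)] followed by the
identification of [M_q] with [(phi^* M)_p]; hence [b] provides a left inverse
of [x^(q - p)] ([scale_gap_injective]).  In degree [q], [eta] is the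
identification of [M_q] with [(phi^* M)_q], which equals [x^(q - p)] applied to
degree [p] of [phi^* M]; hence [b] also provides a preimage of every class of
degree [q] ([scale_gap_surjective]).

What is left is that identifying [M_q] with [(phi^* M)_p] preserves torsion.
Exponents in [phi^* M] fall short of those in [M] by at most a fixed [a], and a
monomial lying in [B^(d + |a|)] lies in [B^d] after division by [x^a], as far
as this is possible: for each of the [|a|] variables removed, one generator is
given up ([power_exponent_drop]). *)

(** * Homogeneous components *)

Lemma sum_enlarge (V : nmodType) (J : eqType) (c : J -> V) (s t : seq J) :
  uniq s -> uniq t -> {subset s <= t} -> (forall r, r \notin s -> c r = 0) ->
  \sum_(r <- s) c r = \sum_(r <- t) c r.
Proof.
move=> us ut st z; rewrite [RHS](bigID (mem s)) /= [X in _ + X]big1 //.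
rewrite addr0 -[RHS]big_filter; apply: perm_big; apply: uniq_perm => //.
  exact: filter_uniq.
by move=> r; rewrite mem_filter /=; case: (boolP (r \in s)) => //= /st ->.
Qed.

Section Components.
Variables (k : fieldType) (n : nat).
Local Notation S := {mpoly k[n]}.
Local Notation degree := 'rV[int]_n.
Implicit Types (M N : gradedModule k n) (r p q : degree).

Lemma homogeneousC (c : k) : homogeneous 0 (c%:MP : S).
Proof.
move=> m; rewrite msuppC; case: ifP => //= _; rewrite inE => /eqP->.
by apply/rowP => j; rewrite !mxE mnm0E.
Qed.

Lemma homogeneousZX (c : k) (m : 'X_{1..n}) :
  homogeneous (mnm_degree m) (c *: 'X_[m] : S).
Proof. by move=> m' /msuppZ_le; rewrite msuppX inE => /eqP->. Qed.

Lemma gr_scale M p (c : k) u : gr (g := M) p u -> gr p (c%:MP *: u).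
Proof. by move=> pu; rewrite -[p]add0r; apply: grM => //; exact: homogeneousC. Qed.

Lemma grN M p u : gr (g := M) p u -> gr p (- u).
Proof.
move=> pu; have -> : - u = (- 1 : k)%:MP *: u by rewrite mpolyCN scaleN1r.
exact: gr_scale.
Qed.

Lemma gr_monomial M p (c : k) (m : 'X_{1..n}) u :
  gr (g := M) p u -> gr (mnm_degree m + p) ((c *: 'X_[m]) *: u).
Proof. by move=> pu; apply: grM => //; exact: homogeneousZX. Qed.

Lemma gr_sum M p (J : eqType) (s : seq J) (F : J -> M) :
  (forall x, x \in s -> gr p (F x)) -> gr p (\sum_(x <- s) F x).
Proof.
move=> H; rewrite big_seq; elim/big_ind: _ => [||x /H//]; first exact: gr0.
exact: grD.
Qed.

(** The list only witnesses that the family [c] has finite support; the degrees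
outside of the support may or may not be listed. *)
Definition is_decomposition M (u : M) (c : degree -> M) : Prop :=
  (forall r, gr r (c r)) /\
  exists s : seq degree, [/\ uniq s, forall r, r \notin s -> c r = 0 &
    u = \sum_(r <- s) c r].

Lemma decomposition_exists M (u : M) : exists c, is_decomposition u c.
Proof.
have [s [f [fgr ->]]] := gr_span u.
exists (fun r => f r *+ count_mem r s); split.
  by move=> r; elim: (count_mem r s) => [|j IHj]; [exact: gr0|rewrite mulrS; exact: grD].
exists (undup s); split; first exact: undup_uniq.
  by move=> r; rewrite mem_undup => /count_memPn ->.
by rewrite -big_undup_iterop_count.
Qed.

Lemma decompositionD M (u v : M) c1 c2 :
  is_decomposition u c1 -> is_decomposition v c2 -> is_decomposition (u + v) (c1 \+ c2).
Proof.
move=> [g1 [s1 [us1 z1 ->]]] [g2 [s2 [us2 z2 ->]]].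
split; first by move=> r; exact: grD.
exists (undup (s1 ++ s2)); split; first exact: undup_uniq.
  by move=> r; rewrite mem_undup mem_cat negb_or /= => /andP[/z1-> /z2->]; rewrite addr0.
rewrite big_split /=; congr (_ + _); apply: sum_enlarge; rewrite ?undup_uniq //;
  by move=> r rs; rewrite mem_undup mem_cat rs ?orbT.
Qed.

Lemma decompositionN M (u : M) c :
  is_decomposition u c -> is_decomposition (- u) (\- c).
Proof.
move=> [g [s [us z ->]]]; split; first by move=> r; exact: grN.
exists s; rewrite -sumrN; split=> // r rs.
by rewrite -[LHS]/(- c r) z // oppr0.
Qed.

Lemma decomposition0 M (c : degree -> M) : is_decomposition 0 c -> forall r, c r = 0.
Proof.
move=> [g [s [us z E]]] r; have [rs|/z//] := boolP (r \in s).
exact: (gr_direct us g (esym E) rs).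
Qed.

Definition component M (r : degree) (u : M) : M :=
  projT1 (cid (decomposition_exists u)) r.

Lemma componentP M (u : M) : is_decomposition u (fun r => component r u).
Proof. exact: (projT2 (cid (decomposition_exists u))). Qed.

Lemma componentE M (u : M) c r : is_decomposition u c -> component r u = c r.
Proof.
move=> uc; apply/eqP; rewrite -subr_eq0; apply/eqP.
have := decompositionD (componentP u) (decompositionN uc).
by rewrite subrr => /decomposition0/(_ r).
Qed.

Lemma component_gr M r (u : M) : gr r (component r u).
Proof. by case: (componentP u). Qed.

Lemma component_homogeneous M p r (u : M) :
  gr p u -> component r u = if r == p then u else 0.
Proof.
move=> pu; apply: (@componentE _ _ (fun r => if r == p then u else 0)); split.
  by move=> t; case: eqP => [->|_] //; exact: gr0.
exists [:: p]; split=> //; last by rewrite big_seq1 eqxx.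
by move=> t; rewrite inE => /negbTE->.
Qed.

Lemma component_id M p (u : M) : gr p u -> component p u = u.
Proof. by move=> /(component_homogeneous p); rewrite eqxx. Qed.

Lemma componentD M r (u v : M) : component r (u + v) = component r u + component r v.
Proof. by rewrite (componentE r (decompositionD (componentP u) (componentP v))). Qed.

Lemma component0 M r : component r (0 : M) = 0.
Proof. by have := component_homogeneous r (gr0 M 0); rewrite if_same. Qed.

Lemma component_sum M r (J : Type) (s : seq J) (P : pred J) (F : J -> M) :
  component r (\sum_(x <- s | P x) F x) = \sum_(x <- s | P x) component r (F x).
Proof.
exact: (big_morph (fun u : M => component r u) (componentD r) (component0 M r)).
Qed.

Lemma component_inj M (u : M) : (forall r, component r u = 0) -> u = 0.
Proof. by move=> H; have [_ [s [_ _ ->]]] := componentP u; rewrite big1. Qed.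

Lemma component_monomial M r (c : k) (m : 'X_{1..n}) (u : M) :
  component r ((c *: 'X_[m]) *: u) =
  (c *: 'X_[m]) *: component (r - mnm_degree m) u.
Proof.
have [ug [s [us z Eu]]] := componentP u.
apply: (@componentE _ _ (fun r => (c *: 'X_[m]) *: component (r - mnm_degree m) u)).
split=> [t|].
  rewrite -{1}[t](subrK (mnm_degree m)) addrC; apply: gr_monomial.
  exact: component_gr.
exists [seq t + mnm_degree m | t <- s]; split.
- by rewrite map_inj_uniq //; exact: addIr.
- move=> t ts; rewrite z ?scaler0 //; apply: contra ts => ts.
  by apply/mapP; exists (t - mnm_degree m); rewrite // subrK.
by rewrite {1}Eu scaler_sumr big_map; apply: eq_bigr => t _; rewrite addrK.
Qed.

Lemma component_scale M r (f : S) (u : M) :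
  component r (f *: u) =
  \sum_(m <- msupp f) (f@_m *: 'X_[m]) *: component (r - mnm_degree m) u.
Proof.
rewrite {1}[f]mpolyE scaler_suml component_sum.
by apply: eq_bigr => m _; exact: component_monomial.
Qed.

Lemma component_linear M N r (f : {linear M -> N}) u :
  degree_preserving f -> component r (f u) = f (component r u).
Proof.
move=> fgr; have [ug [s [us z Eu]]] := componentP u.
apply: (@componentE _ _ (fun r => f (component r u))); split.
  by move=> t; exact/fgr/ug.
exists s; split=> //; first by move=> t /z ->; rewrite linear0.
by rewrite {1}Eu linear_sum.
Qed.

End Components.

(** * Extension of graded maps into injective modules *)

Section Extension.
Variables (k : fieldType) (n : nat).
Local Notation S := {mpoly k[n]}.
Local Notation degree := 'rV[int]_n.

Section Image.
Variables (A B : gradedModule k n) (g : {linear A -> B}).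
Hypothesis gdeg : degree_preserving g.

Definition image_pred : {pred B} := fun v => `[< exists u, g u = v >].

Lemma image_pred_submod : subsemimod_closed image_pred.
Proof.
split; [split|].
- by apply/asboolP; exists 0; rewrite linear0.
- move=> v w /asboolP[u <-] /asboolP[t <-]; apply/asboolP; exists (u + t).
  by rewrite linearD.
by move=> a v /asboolP[u <-]; apply/asboolP; exists (a *: u); rewrite linearZ.
Qed.

HB.instance Definition _ :=
  GRing.isSubmodClosed.Build S B image_pred image_pred_submod.

Definition image_sort : lmodType S := submod image_pred.

Definition image_gr (p : degree) : set image_sort := [set z | gr p (val z)].

Lemma image_gr0 p : image_gr p 0. Proof. exact: gr0. Qed.

Lemma image_grD p u v : image_gr p u -> image_gr p v -> image_gr p (u + v).
Proof. exact: grD. Qed.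

Lemma image_grM a p f u : homogeneous a f -> image_gr p u -> image_gr (a + p) (f *: u).
Proof. exact: grM. Qed.

Lemma image_gr_span z : exists (s : seq degree) (f : degree -> image_sort),
  (forall p, image_gr p (f p)) /\ z = \sum_(p <- s) f p.
Proof.
have /asboolP[u gu] := valP z.
have gP r : g (component r u) \in image_pred by apply/asboolP; exists (component r u).
have [ug [s [_ _ Eu]]] := componentP u.
exists s, (fun r => Sub (g (component r u)) (gP r)); split.
  by move=> r; exact/gdeg/ug.
apply: val_inj; rewrite -gu [in LHS]Eu linear_sum raddf_sum /=.
by apply: eq_bigr => r _.
Qed.

Lemma image_gr_direct (s : seq degree) (f : degree -> image_sort) : uniq s ->
  (forall p, image_gr p (f p)) -> \sum_(p <- s) f p = 0 ->
  forall p, p \in s -> f p = 0.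
Proof.
move=> us fg E p ps; apply: val_inj; rewrite /=.
apply: (gr_direct (f := fun p => val (f p)) us fg _ ps).
by rewrite -raddf_sum E.
Qed.

Definition imageModule : gradedModule k n :=
  GradedModule image_gr0 image_grD image_grM image_gr_span image_gr_direct.

End Image.

(** Injectivity extends maps along monomorphisms only; here [f] is first factored
through the image of [g], a graded submodule of [B]. *)
Lemma injective_extension (A B E : gradedModule k n)
    (g : {linear A -> B}) (f : {linear A -> E}) :
  graded_injective E -> degree_preserving g -> degree_preserving f ->
  (forall u, g u = 0 -> f u = 0) ->
  exists h : {linear B -> E}, degree_preserving h /\ forall u, h (g u) = f u.
Proof.
move=> injE gdeg fdeg ker; pose C := imageModule gdeg.
have ex (z : C) : exists u, g u = val z by apply/asboolP; exact: (valP z).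
(* The map induced by [f] on the image of [g]: any preimage gives the same value. *)
pose fb (z : C) : E := f (projT1 (cid (ex z))).
have fbE (z : C) u : g u = val z -> fb z = f u.
  move=> gu; rewrite /fb; case: cid => v /= gv; apply/eqP; rewrite -subr_eq0 -linearB.
  by rewrite ker // linearB gu gv subrr.
have fbL : linear fb.
  move=> a z w; have [u gu] := ex z; have [v gv] := ex w.
  rewrite (fbE _ _ gu) (fbE _ _ gv) (fbE _ (a *: u + v)) ?linearP //.
  by rewrite gu gv.
pose fl : {linear C -> E} := HB.pack fb (GRing.isLinear.Build _ _ _ _ fb fbL).
pose j : {linear C -> B} := (val : image_sort g -> B).
have [||| h [hdeg hE]] := injE C B j fl.
- by move=> p z.
- move=> p z pz; have [u gu] := ex z; rewrite /= /fl /= (fbE z (component p u)).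
    exact/fdeg/component_gr.
  by rewrite -component_linear // gu component_id.
- exact: val_inj.
exists h; split=> // u.
have gP : g u \in image_pred g by apply/asboolP; exists u.
by rewrite -[g u]/(j (Sub (g u) gP : image_sort g)) hE; exact: fbE.
Qed.

End Extension.

(** * Pullback of a graded module along a collapse of degrees *)

Section MonomialSums.
Variables (k : fieldType) (n : nat) (V : zmodType).
Local Notation S := {mpoly k[n]}.
Variable F : k -> 'X_{1..n} -> V.
Hypothesis FD : forall m, {morph F^~ m : a b / a + b}.

(** The linear extension to polynomials of a map given on the terms [c x^m]. *)
Definition monomial_sum (f : S) : V := \sum_(m <- msupp f) F f@_m m.

Let F0 m : F 0 m = 0.
Proof. by apply: (addrI (F 0 m)); rewrite -FD !addr0. Qed.

(** The support of a sum or a product is not the union or the sum of the supports,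
so computations start by enlarging the range of summation. *)
Lemma monomial_sum_enlarge (f : S) (s : seq 'X_{1..n}) : uniq s ->
  {subset msupp f <= s} -> monomial_sum f = \sum_(m <- s) F f@_m m.
Proof.
move=> us fs; apply: sum_enlarge; rewrite ?msupp_uniq //.
by move=> m /memN_msupp_eq0->.
Qed.

Lemma monomial_sumD f g : monomial_sum (f + g) = monomial_sum f + monomial_sum g.
Proof.
pose s := undup (msupp f ++ msupp g).
have us : uniq s by exact: undup_uniq.
rewrite !(@monomial_sum_enlarge _ s) // => [|m|m|m /msuppD_le]; rewrite ?mem_undup ?mem_cat.
- by rewrite -big_split; apply: eq_bigr => m _; rewrite mcoeffD FD.
- by move=> ->; rewrite orbT.
- by move=> ->.
by [].
Qed.

Lemma monomial_sumX c m : monomial_sum (c *: 'X_[m]) = F c m.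
Proof.
rewrite (@monomial_sum_enlarge _ [:: m]) //; last by move=> m' /msuppZ_le; rewrite msuppX.
by rewrite big_seq1 mcoeffZ mcoeffX eqxx mulr1.
Qed.

Lemma monomial_sum_sum (J : Type) (s : seq J) (f : J -> S) :
  monomial_sum (\sum_(x <- s) f x) = \sum_(x <- s) monomial_sum (f x).
Proof.
apply: (big_morph _ monomial_sumD).
by rewrite /monomial_sum msupp0 big_nil.
Qed.

Lemma monomial_sumM f g : monomial_sum (f * g) =
  \sum_(m <- msupp f) \sum_(l <- msupp g) F (f@_m * g@_l) (m + l)%MM.
Proof.
rewrite {1}[f]mpolyE {1}[g]mpolyE mulr_suml monomial_sum_sum.
apply: eq_bigr => m _; rewrite mulr_sumr monomial_sum_sum.
apply: eq_bigr => l _.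
by rewrite -scalerAl -scalerAr scalerA -mpolyXD monomial_sumX.
Qed.

End MonomialSums.

Section Collapse.
Variables (k : fieldType) (n : nat).
Local Notation S := {mpoly k[n]}.
Local Notation degree := 'rV[int]_n.
Implicit Types r s t : degree.

(** The operations on entries are those of [int] itself, as [lia] requires, rather
than those of a matrix with entries in a generic module. *)
Lemma degreeE : (forall r s (j : 'I_n), (r + s) ord0 j = r ord0 j + s ord0 j :> int) *
  (forall r (j : 'I_n), (- r) ord0 j = - r ord0 j :> int) *
  (forall (m : 'X_{1..n}) (j : 'I_n), mnm_degree m ord0 j = (m j)%:Z).
Proof. by split; [split|] => *; rewrite !mxE. Qed.

Lemma degreeP r s : (forall j, r ord0 j = s ord0 j) -> r = s.
Proof. by move=> H; apply/rowP => j; exact: H. Qed.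

Definition dle r s := forall j : 'I_n, r ord0 j <= s ord0 j.

Lemma dle_subX s (m : 'X_{1..n}) : dle (s - mnm_degree m) s.
Proof. by move=> j; rewrite !degreeE; lia. Qed.

(** The exponent [s - r], meaningful when [r <= s]. *)
Definition gap r s : 'X_{1..n} := [multinom `|s ord0 j - r ord0 j|%N | j < n].

Lemma gapK r s : dle r s -> mnm_degree (gap r s) + r = s.
Proof. by move=> rs; apply: degreeP => j; rewrite !degreeE mnmE; have := rs j; lia. Qed.

Lemma gap_trans s r t : dle r s -> dle s t -> gap r t = (gap s t + gap r s)%MM.
Proof.
by move=> rs st; apply/mnmP => j; rewrite mnmDE !mnmE; have := rs j; have := st j; lia.
Qed.

Lemma gap_refl r : gap r r = 0%MM.
Proof. by apply/mnmP => j; rewrite mnm0E mnmE; lia. Qed.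

Definition collapse (p q r : degree) : degree :=
  \row_j (if p ord0 j <= r ord0 j <= q ord0 j then q ord0 j else r ord0 j).

Variables p q : degree.
Local Notation phi := (collapse p q).

Lemma collapse_mono r s : dle r s -> dle (phi r) (phi s).
Proof. by move=> rs j; rewrite !mxE; have := rs j; do 2 case: ifP; lia. Qed.

Lemma collapse_ge r : dle r (phi r).
Proof. by move=> j; rewrite !mxE; case: ifP; lia. Qed.

Lemma collapse_subX s m : dle (phi (s - mnm_degree m)) (phi s).
Proof. exact/collapse_mono/dle_subX. Qed.

Lemma collapse_right : phi q = q.
Proof. by apply: degreeP => j; rewrite !mxE if_same. Qed.

Lemma collapse_left : dle p q -> phi p = q.
Proof. by move=> pq; apply: degreeP => j; rewrite !mxE pq lexx. Qed.

Variable M : gradedModule k n.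

(** The direct sum over [r] of the components [M_(phi r)], inside the functions from
degrees to [M]; this provides the additive structure of the pullback. *)
Definition family_pred : {pred degree -> M} := fun u =>
  `[< (forall r, gr (phi r) (u r)) /\
      exists s : seq degree, forall r, r \notin s -> u r = 0 >].

Lemma family_zmod : zmod_closed family_pred.
Proof.
split; first by apply/asboolP; split=> [r|]; [exact: gr0|exists [::]].
move=> u v /asboolP[ug [s uz]] /asboolP[vg [t vz]]; apply/asboolP; split.
  by move=> r; apply: grD => //; exact: grN.
exists (s ++ t) => r; rewrite mem_cat negb_or => /andP[/uz ru /vz rv].
by rewrite -[LHS]/(u r - v r) ru rv subrr.
Qed.

HB.instance Definition _ := GRing.isZmodClosed.Build (degree -> M) family_pred family_zmod.

Definition pullback : Type := {u : degree -> M | u \in family_pred}.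
HB.instance Definition _ := SubChoice.on pullback.
HB.instance Definition _ := [SubChoice_isSubZmodule of pullback by <:].

Definition fam (w : pullback) : degree -> M := val w.

Lemma fam_gr w r : gr (phi r) (fam w r).
Proof. by have /asboolP[] := valP w. Qed.

Lemma fam_supp w : exists s : seq degree, uniq s /\ forall r, r \notin s -> fam w r = 0.
Proof.
have /asboolP[_ [s sP]] := valP w; exists (undup s); rewrite undup_uniq; split=> //.
by move=> r; rewrite mem_undup; exact: sP.
Qed.

Lemma famD v w r : fam (v + w) r = fam v r + fam w r. Proof. by []. Qed.
Lemma fam0 r : fam 0 r = 0. Proof. by []. Qed.
Lemma fam_ext v w : (forall r, fam v r = fam w r) -> v = w.
Proof. by move=> H; apply/val_inj/funext. Qed.

Lemma fam_sum (J : Type) (s : seq J) (f : J -> pullback) r :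
  fam (\sum_(x <- s) f x) r = \sum_(x <- s) fam (f x) r.
Proof. by elim/big_rec2: _ => // x y z _ <-. Qed.

Lemma mkfam_subproof (u : degree -> M) : (forall r, gr (phi r) (u r)) ->
  (exists s : seq degree, forall r, r \notin s -> u r = 0) -> u \in family_pred.
Proof. by move=> ug us; exact/asboolP. Qed.

Definition mkfam u ug us : pullback := Sub u (@mkfam_subproof u ug us).

(** The term [c x^m] sends the entry at [s - m], of degree [phi (s - m)], to the
entry at [s], of degree [phi s]; so it acts through [x^(phi s - phi (s - m))]. *)
Definition act_term (u : degree -> M) s (c : k) (m : 'X_{1..n}) : M :=
  (c *: 'X_[gap (phi (s - mnm_degree m)) (phi s)]) *: u (s - mnm_degree m).

Lemma act_termD u s m : {morph (act_term u s)^~ m : a b / a + b}.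
Proof. by move=> a b; rewrite /act_term scalerDl scalerDl. Qed.

Definition act_fun (f : S) (u : degree -> M) s : M := monomial_sum (act_term u s) f.

Lemma act_gr f w s : gr (phi s) (act_fun f (fam w) s).
Proof.
apply: gr_sum => m _; rewrite /act_term.
by rewrite -{1}(gapK (collapse_subX s m)); exact/gr_monomial/fam_gr.
Qed.

Lemma act_supp f w : exists s : seq degree, forall r, r \notin s -> act_fun f (fam w) r = 0.
Proof.
have [s [_ sz]] := fam_supp w.
exists [seq t + mnm_degree m | t <- s, m <- msupp f] => r rs.
rewrite /act_fun /monomial_sum big_seq big1 // => m mf.
rewrite /act_term sz ?scaler0 //; apply: contra rs => rs.
by apply/allpairsP; exists (r - mnm_degree m, m); rewrite /= subrK.
Qed.

Definition act f w : pullback := mkfam (act_gr f w) (act_supp f w).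

(** [x^l], then [x^m] lead from degree [phi (s - m - l)] to [phi s] through
[phi (s - m)]; the two exponents add up. *)
Lemma actA a b w : act a (act b w) = act (a * b) w.
Proof.
apply: fam_ext => s; rewrite -[LHS]/(monomial_sum (act_term (act_fun b (fam w)) s) a).
rewrite -[RHS]/(monomial_sum (act_term (fam w) s) (a * b)).
rewrite monomial_sumM; last exact: act_termD.
apply: eq_bigr => m _; rewrite /act_term /act_fun /monomial_sum scaler_sumr.
apply: eq_bigr => l _; rewrite /act_term scalerA.
have El : s - mnm_degree m - mnm_degree l = s - mnm_degree (m + l).
  by apply: degreeP => j; rewrite !degreeE mnmDE; lia.
rewrite El -scalerAl -scalerAr scalerA -mpolyXD -gap_trans //; last exact: collapse_subX.
by rewrite -El; exact: collapse_subX.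
Qed.

Lemma act1 : left_id 1 act.
Proof.
move=> w; apply: fam_ext => s; rewrite -[LHS]/(monomial_sum (act_term (fam w) s) 1).
have -> : 1 = 1 *: 'X_[0%MM] :> S by rewrite scale1r mpolyX0.
rewrite monomial_sumX; last exact: act_termD.
have E : s - mnm_degree 0%MM = s by apply: degreeP => j; rewrite !degreeE mnm0E; lia.
by rewrite /act_term E gap_refl mpolyX0 !scale1r.
Qed.

Lemma actDr : right_distributive act +%R.
Proof.
move=> a v w; apply: fam_ext => s; rewrite famD.
rewrite -[LHS]/(\sum_(m <- msupp a) _) -big_split; apply: eq_bigr => m _ /=.
by rewrite /act_term famD scalerDr.
Qed.

Lemma actDl w : {morph act^~ w : a b / a + b}.
Proof.
by move=> a b; apply: fam_ext => s; apply: monomial_sumD; exact: act_termD.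
Qed.

HB.instance Definition _ := GRing.Zmodule_isLmodule.Build S pullback actA act1 actDr actDl.

Lemma famZ f w s : fam (f *: w) s = monomial_sum (act_term (fam w) s) f.
Proof. by []. Qed.

Lemma single_subproof (r s : degree) (u : M) :
  gr (phi s) (if s == r then component (phi r) u else 0).
Proof. by case: eqP => [->|_]; [exact: component_gr|exact: gr0]. Qed.

Lemma single_supp (r : degree) (u : M) : exists t : seq degree,
  forall s, s \notin t -> (if s == r then component (phi r) u else 0) = 0.
Proof. by exists [:: r] => s; rewrite inE => /negbTE->. Qed.

(** A component of [u] is taken so that [u] may be any element, homogeneous of
degree [phi r] or not, as needed for torsion cochains with a given boundary. *)
Definition single r u : pullback := mkfam (single_subproof r ^~ u) (single_supp r u).

Lemma fam_single r u s : fam (single r u) s = if s == r then component (phi r) u else 0.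
Proof. by []. Qed.

Definition pullback_gr r : set pullback := [set w | forall s, s != r -> fam w s = 0].

Lemma pullback_gr0 r : pullback_gr r 0. Proof. by []. Qed.

Lemma pullback_grD r v w : pullback_gr r v -> pullback_gr r w -> pullback_gr r (v + w).
Proof. by move=> vr wr s sr; rewrite famD vr // wr // addr0. Qed.

Lemma pullback_grM a r f w :
  homogeneous a f -> pullback_gr r w -> pullback_gr (a + r) (f *: w).
Proof.
move=> fa wr s sr; rewrite famZ /monomial_sum big_seq big1 // => m /fa ma.
rewrite /act_term wr ?scaler0 // ma; apply: contra sr => /eqP <-.
by rewrite addrC subrK.
Qed.

Lemma pullback_span w : exists (s : seq degree) (f : degree -> pullback),
  (forall r, pullback_gr r (f r)) /\ w = \sum_(r <- s) f r.
Proof.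
have [s [us sz]] := fam_supp w; exists s, (fun r => single r (fam w r)); split.
  by move=> r t tr; rewrite fam_single (negbTE tr).
apply: fam_ext => t; rewrite fam_sum.
under eq_bigr do rewrite fam_single.
have [ts|ts] := boolP (t \in s); last first.
  rewrite sz // big_seq big1 // => r rs.
  by case: eqP ts => // ->; rewrite rs.
rewrite (bigD1_seq t) //= eqxx big1 ?addr0; last by move=> r /negbTE; rewrite eq_sym => ->.
by rewrite component_id //; exact: fam_gr.
Qed.

Lemma pullback_direct (s : seq degree) (f : degree -> pullback) : uniq s ->
  (forall r, pullback_gr r (f r)) -> \sum_(r <- s) f r = 0 ->
  forall r, r \in s -> f r = 0.
Proof.
move=> us fg E r rs; apply: fam_ext => t; rewrite fam0.
have [->|/fg//] := eqVneq t r.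
have := congr1 (fun w => fam w r) E; rewrite fam_sum fam0 (bigD1_seq r) //=.
by rewrite big1 ?addr0 // => r' rr'; rewrite fg // eq_sym.
Qed.

Definition pullbackModule : gradedModule k n := GradedModule pullback_gr0 pullback_grD
  pullback_grM pullback_span pullback_direct.

End Collapse.

(** * Monomials in the powers of a monomial ideal *)

Section MonomialPowers.
Variables (k : fieldType) (n : nat) (G : set 'X_{1..n}).
Local Notation S := {mpoly k[n]}.
Local Notation B := (ideal_generated [set ('X_[m] : S) | m in G]).

(** [x^m] is divisible by a product of [d] of the generators [x^g]. *)
Fixpoint power_exponent (d : nat) (m : 'X_{1..n}) : Prop :=
  if d is e.+1 then exists g, [/\ G g, (g <= m)%MM & power_exponent e (m - g)%MM]
  else True.

Lemma power_exponent_up d m l : (m <= l)%MM -> power_exponent d m -> power_exponent d l.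
Proof.
elim: d m l => //= d IHd m l ml [g [Gg gm mgd]]; exists g; split=> //.
  exact: lepm_trans gm ml.
apply: IHd mgd; apply/mnm_lepP => j; rewrite !mnmBE.
by have /mnm_lepP/(_ j) := ml; lia.
Qed.

(** Dividing by one variable spoils at most one of the generators dividing [x^m]:
one that contains this variable can be given up. *)
Lemma power_exponent_drop1 d m j :
  power_exponent d.+1 m -> power_exponent d (m - U_(j))%MM.
Proof.
elim: d m => //= d IHd m [g [Gg gm mgd]].
have [gj|gj] := posnP (g j).
  exists g; split=> //.
    apply/mnm_lepP => i; rewrite mnmBE mnm1E; have /mnm_lepP/(_ i) := gm.
    by case: eqP => [<-|_]; lia.
  by rewrite submDA addmC -submDA; exact: IHd.
apply: (@power_exponent_up d.+1 _ _ _ mgd).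
apply/mnm_lepP => i; rewrite !mnmBE mnm1E.
by case: eqP => [<-|_]; lia.
Qed.

(** Truncated subtraction: [x^(m - a)] drops from [x^m] as much of [x^a] as it
contains. *)
Lemma power_exponent_drop d a m :
  power_exponent (d + mdeg a) m -> power_exponent d (m - a)%MM.
Proof.
move E : (mdeg a) => e; elim: e a d E => [|e IHe] a d E.
  by move/eqP: E; rewrite mdeg_eq0 addn0 => /eqP ->; rewrite subm0.
have /existsP[j aj] : [exists j, (0 < a j)%N].
  apply: contraT; rewrite negb_exists => /forallP a0.
  move: E; rewrite mdegE big1 // => j _.
  by have := a0 j; case: (a j).
have ja : (U_(j) <= a)%MM by rewrite lep1mP -lt0n.
have Ea : mdeg (a - U_(j)) = e.
  by move: E; rewrite -{1}(submK ja) mdegD mdeg1 addn1 => -[].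
rewrite addnS -addSn => /(IHe _ _ Ea)/power_exponent_drop1 => /(_ j).
by rewrite submDA submK.
Qed.

Lemma ideal_generated_exponent f m : B f -> m \in msupp f -> exists2 g, G g & (g <= m)%MM.
Proof.
move=> [s [sB ->]] /msupp_sum_le /flattenP[t /mapP[[a b] abs ->]] /=.
rewrite mem_filter /= in abs; have [g Gg /= <-] := sB _ abs.
move=> /msuppM_le /allpairsP[[m1 m2] /= [_]].
by rewrite msuppX inE => /eqP -> ->; exists g => //; exact: lem_addl.
Qed.

Lemma ideal_power_exponent d f m :
  ideal_power B d f -> m \in msupp f -> power_exponent d m.
Proof.
move=> [s [sB ->]] /msupp_sum_le /flattenP[l /mapP[[a b] abs ->]] /=.
rewrite mem_filter /= in abs; have [t [tB /= ->]] := sB _ abs.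
move=> /msuppM_le /allpairsP[[m1 m2] /= [_ mt ->]].
apply: (power_exponent_up (lem_addl _ _)); move: mt; clear -tB.
elim: d t tB m2 => //= d IHd t tB m; rewrite big_ord_recl.
move=> /msuppM_le /allpairsP[[m1 m2] /= [/(ideal_generated_exponent (tB ord0))[g Gg gm1] mt ->]].
exists g; split=> //; first exact: lepm_trans (lem_addr _ _).
apply: power_exponent_up (IHd _ _ _ mt) => [|i]; last exact: tB.
by apply/mnm_lepP => i; rewrite mnmBE mnmDE; have /mnm_lepP/(_ i) := gm1; lia.
Qed.

Lemma power_exponent_ideal d m : power_exponent d m -> ideal_power B d 'X_[m].
Proof.
move=> md; suff [t [tB [c E]]] : exists t : 'I_d -> S, (forall i, B (t i)) /\
    exists c, 'X_[m] = c * \prod_(i < d) t i.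
  exists [:: (c, \prod_(i < d) t i)]; rewrite big_seq1; split=> // ag.
  by rewrite inE => /eqP->; exists t.
elim: d m md => [|d IHd] m /=.
  by move=> _; exists (fun=> 0); split=> [[]//|]; exists 'X_[m]; rewrite big_ord0 mulr1.
move=> [g [Gg gm /IHd[t [tB [c E]]]]].
exists (fun i => if unlift ord0 i is Some j then t j else 'X_[g]); split.
  move=> i; case: unliftP => [j _|_] //.
  exists [:: (1, 'X_[g])]; rewrite big_seq1 mul1r; split=> // ag.
  by rewrite inE => /eqP->; exists g.
exists c; rewrite big_ord_recl unlift_none; under eq_bigr do rewrite liftK.
by rewrite mulrCA -E -mpolyXD addmC submK.
Qed.

End MonomialPowers.

(** * Functoriality and unit of the pullback *)

Section PullbackMaps.
Variables (k : fieldType) (n : nat) (p q : 'rV[int]_n).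
Local Notation S := {mpoly k[n]}.
Local Notation degree := 'rV[int]_n.
Local Notation phi := (collapse p q).
Local Notation pullback_of M := (pullbackModule p q M).
Implicit Types (M N : gradedModule k n) (r s : degree).

Section Functor.
Variables (M N : gradedModule k n) (f : {linear M -> N}).
Hypothesis fdeg : degree_preserving f.

Lemma pullback_map_gr (w : pullback_of M) r : gr (phi r) (f (fam w r)).
Proof. exact/fdeg/fam_gr. Qed.

Lemma pullback_map_supp (w : pullback_of M) :
  exists s : seq degree, forall r, r \notin s -> f (fam w r) = 0.
Proof. by have [s [_ sz]] := fam_supp w; exists s => r /sz ->; rewrite linear0. Qed.

Definition pullback_map_fun (w : pullback_of M) : pullback_of N :=
  mkfam (pullback_map_gr w) (pullback_map_supp w).

Lemma pullback_map_linear : linear pullback_map_fun.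
Proof.
move=> a v w; apply: fam_ext => r.
rewrite -[LHS]/(f (fam (a *: v + w) r)) famD linearD; congr (_ + _).
rewrite famZ linear_sum; apply: eq_bigr => m _.
by rewrite /act_term linearZ.
Qed.

HB.instance Definition _ := GRing.isLinear.Build S (pullback_of M) (pullback_of N) _
  pullback_map_fun pullback_map_linear.

Definition pullback_map : {linear pullback_of M -> pullback_of N} := pullback_map_fun.

Lemma fam_pullback_map w r : fam (pullback_map w) r = f (fam w r).
Proof. by []. Qed.

Lemma pullback_map_degree : degree_preserving pullback_map.
Proof. by move=> r w wr s sr; rewrite fam_pullback_map wr // linear0. Qed.

Lemma pullback_map_single r u : pullback_map (single p q r u) = single p q r (f u).
Proof.
apply: fam_ext => s; rewrite fam_pullback_map !fam_single.
by case: eqP => _; rewrite ?linear0 // component_linear.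
Qed.

(** Exactness can be checked entry by entry.  Preimages are made homogeneous by
taking components, and chosen zero where the family vanishes, to keep the
support finite. *)
Lemma pullback_exact (P : gradedModule k n) (g : {linear N -> P})
    (w : pullback_of N) :
  (forall u, g u = 0 -> exists v, f v = u) ->
  (forall r, g (fam w r) = 0) -> exists v, pullback_map v = w.
Proof.
move=> ex wz.
have H r : exists v, [/\ gr (phi r) v, f v = fam w r & fam w r = 0 -> v = 0].
  have [w0|w0] := EM (fam w r = 0).
    by exists 0; split=> //; [exact: gr0|rewrite linear0 w0].
  have [v fv] := ex _ (wz r); exists (component (phi r) v); split=> //.
    exact: component_gr.
  by rewrite -component_linear // fv component_id //; exact: fam_gr.
have [v vP] := choice H.
have vg r : gr (phi r) (v r) by case: (vP r).
have vs : exists s : seq degree, forall r, r \notin s -> v r = 0.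
  have [s [_ sz]] := fam_supp w; exists s => r /sz wr.
  by have [_ _] := vP r; apply.
exists (mkfam vg vs : pullback_of M); apply: fam_ext => r.
by rewrite fam_pullback_map; case: (vP r).
Qed.

End Functor.

Section Unit.
Variable M : gradedModule k n.

Lemma unit_gr (u : M) r : gr (phi r) ('X_[gap r (phi r)] *: component r u).
Proof.
rewrite -{1}(gapK (collapse_ge p q r)) -['X_[_]]scale1r.
exact/gr_monomial/component_gr.
Qed.

Lemma unit_supp (u : M) : exists s : seq degree,
  forall r, r \notin s -> 'X_[gap r (phi r)] *: component r u = 0.
Proof.
have [_ [s [_ sz _]]] := componentP u.
by exists s => r /sz ->; rewrite scaler0.
Qed.

Definition unit_fun (u : M) : pullback_of M := mkfam (unit_gr u) (unit_supp u).

(** The two paths from degree [r - m] to degree [phi r], through [r] and through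
[phi (r - m)], multiply by the same monomial. *)
Lemma unit_linear : linear unit_fun.
Proof.
move=> a u v; apply: fam_ext => r.
rewrite -[LHS]/('X_[gap r (phi r)] *: component r (a *: u + v)).
rewrite componentD scalerDr famD; congr (_ + _).
rewrite component_scale famZ scaler_sumr; apply: eq_bigr => m _.
rewrite /act_term -[fam _ _]/('X_[_] *: component _ u) !scalerA.
rewrite -scalerAr -scalerAl -!mpolyXD.
set t := r - mnm_degree m; congr (_ *: 'X_[_] *: _).
(* Both exponents equal [phi r - t]. *)
rewrite -gap_trans; [|exact: collapse_ge|exact: collapse_subX].
rewrite (gap_trans (dle_subX r m) (collapse_ge p q r)); congr (_ + _)%MM.
by apply/mnmP => j; rewrite mnmE !degreeE; lia.
Qed.

HB.instance Definition _ := GRing.isLinear.Build S M (pullback_of M) _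
  unit_fun unit_linear.

Definition pullback_unit : {linear M -> pullback_of M} := unit_fun.

Lemma fam_unit u r : fam (pullback_unit u) r = 'X_[gap r (phi r)] *: component r u.
Proof. by []. Qed.

Lemma unit_degree : degree_preserving pullback_unit.
Proof.
by move=> r u ur s /negbTE sr; rewrite fam_unit (component_homogeneous _ ur) sr scaler0.
Qed.

End Unit.

Lemma unit_natural M N (f : {linear M -> N}) (fdeg : degree_preserving f) u :
  pullback_unit N (f u) = pullback_map fdeg (pullback_unit M u).
Proof.
by apply: fam_ext => r; rewrite fam_pullback_map !fam_unit component_linear // linearZ.
Qed.

Lemma unit_left M u : dle p q -> gr (g := M) p u ->
  pullback_unit M u = single p q p ('X_[gap p q] *: u).
Proof.
move=> pq pu; apply: fam_ext => r; rewrite fam_unit fam_single.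
rewrite (component_homogeneous _ pu); case: eqP => [->|_]; last by rewrite scaler0.
rewrite collapse_left // component_id // -{1}(gapK pq) -['X_[_]]scale1r.
exact: gr_monomial.
Qed.

Lemma unit_right M u : gr (g := M) q u -> pullback_unit M u = single p q q u.
Proof.
move=> qu; apply: fam_ext => r; rewrite fam_unit fam_single.
rewrite (component_homogeneous _ qu); case: eqP => [->|_]; last by rewrite scaler0.
by rewrite collapse_right gap_refl mpolyX0 scale1r component_id.
Qed.

(** [phi p = phi q], so this multiplication does not affect the entry. *)
Lemma scale_single M u : dle p q -> gr (g := M) q u ->
  'X_[gap p q] *: (single p q p u : pullback_of M) = single p q q u.
Proof.
move=> pq qu; apply: fam_ext => r; rewrite famZ -['X_[_]]scale1r monomial_sumX.
  rewrite /act_term !fam_single collapse_left // collapse_right.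
  have -> : (r - mnm_degree (gap p q) == p) = (r == q).
    by rewrite subr_eq [p + _]addrC (gapK pq).
  case: eqP => [->|_]; last by rewrite scaler0.
  have -> : q - mnm_degree (gap p q) = p.
    by apply/eqP; rewrite subr_eq [p + _]addrC (gapK pq).
  by rewrite collapse_left // collapse_right gap_refl mpolyX0 !scale1r.
exact: act_termD.
Qed.

Lemma gr_single M r u : gr r (single p q r u : pullback_of M).
Proof. by move=> s /negbTE sr; rewrite fam_single sr. Qed.

End PullbackMaps.

(** * The pullback of the polynomial ring *)

Section UnitPolynomial.
Variables (k : fieldType) (n : nat) (p q : 'rV[int]_n).
Local Notation S := {mpoly k[n]}.
Local Notation degree := 'rV[int]_n.
Local Notation phi := (collapse p q).
Local Notation P := (polynomialModule k n).

Lemma unit_polynomial_inj (u : P) : pullback_unit p q P u = 0 -> u = 0.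
Proof.
move=> u0; apply: component_inj => r; have := fam_unit p q u r.
rewrite u0 fam0 => /esym/eqP; rewrite -[_ *: _]/('X_[_] * (component r u : S)).
rewrite mulf_eq0 => /orP[/eqP X0|/eqP//].
have := mcoeffX k (gap r (phi r)) (gap r (phi r)).
by rewrite X0 mcoeff0 eqxx => /esym/eqP; rewrite oner_eq0.
Qed.

Lemma homogeneous_mnm (f : S) m : homogeneous (mnm_degree m) f -> f = f@_m *: 'X_[m].
Proof.
move=> fm; apply/mpolyP => l; rewrite mcoeffZ mcoeffX.
have [->|ml] := eqVneq; first by rewrite mulr1.
rewrite mulr0; apply: memN_msupp_eq0; apply: contra ml => /fm/mnm_degree_inj ->.
by [].
Qed.

Hypothesis pq : neg p = neg q.

(** An interval of integers of the same sign is collapsed in each coordinate. *)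
Lemma collapse_nonneg r : (forall j, 0 <= phi r ord0 j) -> forall j, 0 <= r ord0 j.
Proof.
move=> H j; have := H j; rewrite !mxE.
have : (j \in neg p) = (j \in neg q) by rewrite pq.
rewrite !inE -[p 0 j]/(p ord0 j) -[q 0 j]/(q ord0 j).
by case: ifP; lia.
Qed.

(** A nonzero entry at [r] is a multiple of [x^(phi r)], where [phi r >= 0]; then
[r >= 0], and the entry is [x^(phi r - r)] times a multiple of [x^r]. *)
Lemma unit_polynomial_surj (w : pullbackModule p q P) :
  exists u, pullback_unit p q P u = w.
Proof.
have H r : exists v : P, [/\ gr r v, 'X_[gap r (phi r)] *: v = fam w r &
    fam w r = 0 -> v = 0].
  have wg : homogeneous (phi r) (fam w r : S) := fam_gr w r.
  have [w0|w0] := EM (fam w r = 0).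
    by exists 0; split=> //; [exact: gr0|rewrite scaler0 w0].
  have [m mw] : exists m, m \in msupp (fam w r : S).
    case E : (msupp _) => [|m s]; last by exists m; rewrite mem_head.
    by case: w0; apply/eqP; rewrite -msupp_eq0 E.
  have Em := wg _ mw; have r0 : forall j, 0 <= r ord0 j.
    by apply: collapse_nonneg => j; rewrite -Em degreeE.
  pose l : 'X_{1..n} := [multinom `|r ord0 j|%N | j < n].
  have Er : mnm_degree l = r.
    by apply: degreeP => j; rewrite degreeE mnmE; have := r0 j; lia.
  exists ((fam w r : S)@_m *: 'X_[l]); split.
  - by rewrite -{1}Er; exact: homogeneousZX.
  - rewrite -[LHS]/('X_[_] * (_ *: 'X_[l])) -scalerAr -mpolyXD.
    rewrite [RHS](@homogeneous_mnm _ m) ?Em //; congr (_ *: 'X_[_]).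
    apply/mnmP => j; rewrite mnmDE !mnmE; have := collapse_ge p q r j.
    have := congr1 (fun t : degree => t ord0 j) Em; rewrite degreeE.
    by have := r0 j; lia.
  by move=> /w0.
have [v vP] := choice H; have [s [us sz]] := fam_supp w.
exists (\sum_(r <- s) v r); apply: fam_ext => r; rewrite fam_unit.
rewrite (@componentE _ _ _ _ v); first by case: (vP r).
split; first by move=> t; case: (vP t).
by exists s; split=> // t /sz wt; case: (vP t) => _ _; apply.
Qed.

End UnitPolynomial.

(** * Torsion in the pullback *)

Section Torsion.
Variables (k : fieldType) (n : nat).
Local Notation S := {mpoly k[n]}.
Variable B : set S.

Lemma torsion_linear (M N : gradedModule k n) (f : {linear M -> N}) u :
  u \in torsion B M -> f u \in torsion B N.
Proof.
move=> /asboolP[d ud]; apply/asboolP; exists d => g gd.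
by rewrite -linearZ /= ud // linear0.
Qed.

Variables (G : set 'X_{1..n}) (p q : 'rV[int]_n) (M : gradedModule k n).
Hypothesis BG : B = ideal_generated [set ('X_[m] : S) | m in G].

(** If [B^d] kills [u], then [B^(d + |a|)] kills the family, with [a = phi r - r].
Indeed [x^m] acts on it through an exponent [phi (r + m) - phi r >= m - a]. *)
Lemma torsion_single r (u : M) :
  u \in torsion B M -> single p q r u \in torsion B (pullbackModule p q M).
Proof.
move=> /asboolP[d ud]; pose a := gap r (collapse p q r).
apply/asboolP; exists (d + mdeg a)%N => f fd; apply: fam_ext => s.
rewrite famZ /monomial_sum big_seq big1 // => m mf.
rewrite /act_term fam_single; case: eqP => [Er|_]; last by rewrite scaler0.
set e := gap _ _.
have ea : (m - a <= e)%MM.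
  apply/mnm_lepP => j; rewrite mnmBE /e Er !mnmE.
  have := collapse_ge p q s j; have := collapse_ge p q r j.
  have := collapse_subX p q s m j; rewrite Er.
  have := congr1 (fun t : 'rV[int]_n => t ord0 j) Er; rewrite !degreeE.
  by lia.
have Xu : 'X_[m - a] *: u = 0.
  apply: ud; rewrite BG; apply: power_exponent_ideal; apply: power_exponent_drop.
  by apply: (@ideal_power_exponent _ _ _ _ f); rewrite // -BG.
rewrite -(submK ea) mpolyXD scalerAl -scalerA; set x := 'X_[m - a] *: _.
suff -> : x = 0 by rewrite scaler0.
have := component_monomial (collapse p q r + mnm_degree (m - a)) 1 (m - a) u.
by rewrite scale1r Xu component0 addrK => E; rewrite /x -E.
Qed.

End Torsion.

(** Dependent choice along a family of types, with an invariant [P] that makes each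
step possible. *)

(** * The pulled back resolution retracts onto the resolution *)

Lemma dependent_sequence (T : nat -> Type) (P : forall i, T i -> Prop)
    (R : forall i, T i -> T i.+1 -> Prop) :
  (exists x, P 0%N x) ->
  (forall i x, P i x -> exists y, P i.+1 y /\ R i x y) ->
  exists x : forall i, T i, forall i, P i (x i) /\ R i (x i) (x i.+1).
Proof.
move=> /cid[x0 Px0] step.
pose st i := {x : T i | P i x}.
have next i (x : st i) : {y : st i.+1 | R i (projT1 x) (projT1 y)}.
  case: x => x Px; have /cid[y [Py Rxy]] := step i x Px.
  by exists (exist _ y Py).
pose seqn := fix F i : st i := if i is j.+1 then projT1 (next j (F j)) else exist _ x0 Px0.
exists (fun i => projT1 (seqn i)) => i; split; first exact: (projT2 (seqn i)).
exact: (projT2 (next i (seqn i))).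
Qed.

Section Retraction.
Variables (k : fieldType) (n : nat) (p q : 'rV[int]_n).
Local Notation S := {mpoly k[n]}.
Hypothesis npq : neg p = neg q.
Variable I : injectiveResolution (polynomialModule k n).
Local Notation J i := (pullbackModule p q (I i)).
Local Notation d := (diff I).
Local Notation ddeg i := (@diff_degree k n _ I i).
Local Notation adeg := (@aug_degree k n _ I).
Local Notation dJ i := (pullback_map p q (ddeg i)).
Local Notation eta i := (pullback_unit p q (I i)).

Lemma diff_diff i u : d i.+1 (d i u) = 0.
Proof. by apply/diff_exact; exists u. Qed.

Lemma pullback_diff_exact i (w : J i.+1) : dJ i.+1 w = 0 -> exists v, dJ i v = w.
Proof.
move=> w0; apply: (pullback_exact (ddeg i) (g := d i.+1)).
  by move=> u /diff_exact.
by move=> r; rewrite -(fam_pullback_map (ddeg i.+1)) w0.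
Qed.

Lemma pullback_aug_exact (w : J 0%N) : dJ 0%N w = 0 -> exists u, eta 0%N (aug I u) = w.
Proof.
move=> w0; have [||v vw] := pullback_exact adeg (g := d 0%N) (w := w).
- by move=> u /aug_exact.
- by move=> r; rewrite -(fam_pullback_map (ddeg 0)) w0.
have [u uv] := unit_polynomial_surj npq v.
by exists u; rewrite (unit_natural _ _ adeg) uv.
Qed.

Lemma degree_preserving_comp (L M N : gradedModule k n) (f : M -> N) (g : L -> M) :
  degree_preserving f -> degree_preserving g -> degree_preserving (f \o g).
Proof. by move=> fd gd r u ru; exact/fd/gd. Qed.

Lemma degree_preservingB (M N : gradedModule k n) (f g : M -> N) :
  degree_preserving f -> degree_preserving g -> degree_preserving (f \- g).
Proof. by move=> fd gd r u ru; apply: grD; [exact: fd|exact/grN/gd]. Qed.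

(** Maps into an injective term extend along the differentials of an exact complex;
the invariant carried by the construction is that [d b] kills the kernel of the
differential of [phi^* I]. *)
Lemma comparison_exists : exists b : forall i, {linear J i -> I i},
  [/\ forall i, degree_preserving (b i),
      forall i w, d i (b i w) = b i.+1 (dJ i w) &
      forall u, b 0%N (eta 0%N (aug I u)) = aug I u].
Proof.
pose P i (b : {linear J i -> I i}) := [/\ degree_preserving b,
  forall w, dJ i w = 0 -> d i (b w) = 0 &
  match i return {linear J i -> I i} -> Prop with
  | 0 => fun b => forall u, b (eta 0%N (aug I u)) = aug I u
  | _ => fun=> True
  end b].
pose R i (b : {linear J i -> I i}) (b' : {linear J i.+1 -> I i.+1}) :=
  forall w, d i (b w) = b' (dJ i w).
have [|i b [bdeg bker _]|b bP] := @dependent_sequence _ P R.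
- have [|||b [bdeg bE]] := @injective_extension _ _ _ (J 0%N) (I 0%N)
      (eta 0%N \o aug I) (aug I) (@term_injective _ _ _ I 0).
  + by apply: degree_preserving_comp; [exact: unit_degree|exact: aug_degree].
  + exact: aug_degree.
  + move=> u /=; rewrite (unit_natural _ _ adeg) => u0.
    suff -> : u = 0 by rewrite linear0.
    apply: (@unit_polynomial_inj _ _ p q); apply: fam_ext => r; rewrite fam0.
    apply: (@aug_injective _ _ _ I); rewrite linear0.
    by rewrite -(fam_pullback_map adeg) u0.
  exists b; split=> // w /pullback_aug_exact[u <-].
  by rewrite -[eta _ _]/((eta 0%N \o aug I) u) bE; apply/aug_exact; exists u.
- have [|||b' [bdeg' bE]] := @injective_extension _ _ _ (J i.+1) (I i.+1)
      (dJ i) (d i \o b) (@term_injective _ _ _ I i.+1).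
  + exact: pullback_map_degree.
  + by apply: degree_preserving_comp => //; exact: diff_degree.
  + exact: bker.
  exists b'; split; last by move=> w; rewrite bE.
  split=> // w /pullback_diff_exact[v <-].
  by rewrite bE /= diff_diff.
exists b; split=> [i|i|]; first by have [[]] := bP i.
  by have [_] := bP i.
by have [[]] := bP 0%N.
Qed.

(** [b eta] and the identity extend the same map [S -> I 0]; the usual construction
of a homotopy applies. *)
Lemma retraction_homotopic (b : forall i, {linear J i -> I i}) :
  (forall i, degree_preserving (b i)) ->
  (forall i w, d i (b i w) = b i.+1 (dJ i w)) ->
  (forall u, b 0%N (eta 0%N (aug I u)) = aug I u) ->
  exists h : forall i, {linear I i.+1 -> I i},
    (forall u, b 0%N (eta 0%N u) - u = h 0%N (d 0%N u)) /\
    (forall i u, b i.+1 (eta i.+1 u) - u = d i (h i u) + h i.+1 (d i.+1 u)).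
Proof.
move=> bdeg bd baug.
pose th i : {linear I i -> I i} := (b i \o eta i) \- idfun.
have thE i u : th i u = b i (eta i u) - u by [].
have thdeg i : degree_preserving (th i).
  apply: degree_preservingB; last by move=> r u.
  by apply: degree_preserving_comp; [exact: bdeg|exact: unit_degree].
have thd i u : d i (th i u) = th i.+1 (d i u).
  by rewrite !thE linearB bd (unit_natural _ _ (ddeg i)).
pose P i (h : {linear I i.+1 -> I i}) := [/\ degree_preserving h,
  forall u, d i (th i u - h (d i u)) = 0 &
  match i return {linear I i.+1 -> I i} -> Prop with
  | 0 => fun h => forall u, th 0%N u = h (d 0%N u)
  | _ => fun=> True
  end h].
pose R i (h : {linear I i.+1 -> I i}) (h' : {linear I i.+2 -> I i.+1}) :=
  forall u, th i.+1 u = d i (h u) + h' (d i.+1 u).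
have [|i h [hdeg hd _]|h hP] := @dependent_sequence _ P R.
- have [|||h [hdeg hE]] := @injective_extension _ _ _ (I 1%N) (I 0%N)
      (d 0%N) (th 0%N) (@term_injective _ _ _ I 0).
  + exact: diff_degree.
  + exact: thdeg.
  + by move=> u /aug_exact[v <-]; rewrite thE baug subrr.
  by exists h; split=> // u; rewrite hE subrr linear0.
- pose f : {linear I i.+1 -> I i.+1} := th i.+1 \- (d i \o h).
  have fE u : f u = th i.+1 u - d i (h u) by [].
  have [|||h' [hdeg' hE]] := @injective_extension _ _ _ (I i.+2) (I i.+1)
      (d i.+1) f (@term_injective _ _ _ I i.+1).
  + exact: diff_degree.
  + apply: degree_preservingB; first exact: thdeg.
    by apply: degree_preserving_comp => //; exact: diff_degree.
  + move=> u /diff_exact[v <-]; rewrite fE -thd -linearB; exact: hd.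
  exists h'; split; last by move=> u; rewrite hE fE addrC subrK.
  split=> // u; rewrite hE fE opprB addrC subrK.
  exact: diff_diff.
exists h; split=> [u|i u]; rewrite -thE; first by have [[]] := hP 0%N.
by have [_] := hP i.
Qed.

End Retraction.

(** * Multiplication by monomials on local cohomology *)

Section Shift.
Variables (k : fieldType) (n : nat) (G : set 'X_{1..n}).
Local Notation S := {mpoly k[n]}.
Local Notation degree := 'rV[int]_n.
Local Notation B := (ideal_generated [set ('X_[m] : S) | m in G]).
Variable I : injectiveResolution (polynomialModule k n).
Local Notation d := (diff I).
Local Notation H i := (localCohomology B I i).
Local Notation Hgr i := (localCohomology_gr B I i).
Local Notation cls i := (@quotmod_pi _ _ (coboundary B I i)).

Lemma boundaryD i u v : boundary B I i u -> boundary B I i v -> boundary B I i (u + v).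
Proof.
case: i u v => [|i] u v /=; first by move=> -> ->; rewrite addr0.
move=> [u' Tu <-] [v' Tv <-]; exists (u' + v'); rewrite ?linearD //.
by rewrite /= rpredD.
Qed.

Lemma boundaryN i u : boundary B I i u -> boundary B I i (- u).
Proof.
case: i u => [|i] u /=; first by move=> ->; rewrite oppr0.
by move=> [u' Tu <-]; exists (- u'); rewrite ?linearN //= rpredN.
Qed.

Section Collapsed.
Variables (p q : degree).
Hypotheses (npq : neg p = neg q) (pq : dle p q).
Variable b : forall i, {linear pullbackModule p q (I i) -> I i}.
Hypothesis bd : forall i w, d i (b i w) = b i.+1 (pullback_map p q (@diff_degree _ _ _ I i) w).
Variable h : forall i, {linear I i.+1 -> I i}.
Hypothesis bh0 : forall u, b 0%N (pullback_unit p q (I 0%N) u) - u = h 0%N (d 0%N u).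
Hypothesis bhS : forall i u, b i.+1 (pullback_unit p q (I i.+1) u) - u =
  d i (h i u) + h i.+1 (d i.+1 u).

Lemma retraction_boundary i u : u \in torsion B (I i) -> d i u = 0 ->
  boundary B I i (b i (pullback_unit p q (I i) u) - u).
Proof.
case: i u => [|i] u Tu du; first by rewrite bh0 du linear0.
by rewrite bhS du linear0 addr0; exists (h i u) => //=; exact: torsion_linear.
Qed.

(** [b (single p (d v)) = d (b (single p v))], and [single] preserves torsion. *)
Lemma single_boundary i u : boundary B I i u -> boundary B I i (b i (single p q p u)).
Proof.
case: i u => [|i] u /=.
  move=> ->; have -> : single p q p (0 : I 0%N) = 0; last by rewrite linear0.
  by apply: fam_ext => r; rewrite fam_single component0 if_same.
move=> [v Tv <-]; exists (b i (single p q p v)).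
  by apply: torsion_linear; exact: torsion_single.
by rewrite bd pullback_map_single.
Qed.

End Collapsed.

Lemma clsD i (y z : submod (cocycle B I i)) : cls i (y + z) = cls i y + cls i z.
Proof. exact: quotmod_piD. Qed.

Lemma cls0 i : cls i 0 = 0.
Proof. by apply: (addrI (cls i 0)); rewrite -clsD !addr0. Qed.

Lemma clsB i (y z : submod (cocycle B I i)) : cls i (y - z) = cls i y - cls i z.
Proof. by apply: (addIr (cls i z)); rewrite -clsD !subrK. Qed.

Lemma cls_boundary i (z : submod (cocycle B I i)) :
  cls i z = 0 <-> boundary B I i (val z).
Proof.
rewrite -(cls0 i) quotmod_piE subr0; split=> [/asboolP//|zb]; exact/asboolP.
Qed.

Lemma clsZ i f (z : submod (cocycle B I i)) : f *: cls i z = cls i (f *: z).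
Proof. exact: quotmod_scale_pi. Qed.

Lemma cocycle_torsion i (z : submod (cocycle B I i)) :
  val z \in torsion B (I i) /\ d i (val z) = 0.
Proof. by have /andP[zT /eqP dz] := valP z. Qed.

Variables (p q : degree).
Hypotheses (npq : neg p = neg q) (pq : dle p q).

(** If [x^(q - p) z] is a boundary, so is [b (eta z) = b (single p (x^(q - p) z))],
which is cohomologous to [z]. *)
Lemma scale_gap_injective i u : Hgr i p u -> 'X_[gap p q] *: u = 0 -> u = 0.
Proof.
have [b [bdeg bd baug]] := comparison_exists npq I.
have [h [bh0 bhS]] := retraction_homotopic bdeg bd baug.
move=> [z /= zp <-]; rewrite clsZ => /cls_boundary zb; apply/cls_boundary.
have [zT dz] := cocycle_torsion z.
have := retraction_boundary bh0 bhS zT dz; rewrite unit_left //.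
move=> /boundaryN E; have := boundaryD (single_boundary (p := p) bd zb) E.
by rewrite opprB addrC subrK.
Qed.

(** A cocycle [z] of degree [q] is cohomologous to
[b (eta z) = b (single q z) = x^(q - p) b (single p z)]. *)
Lemma scale_gap_surjective i v : Hgr i q v ->
  exists2 u, Hgr i p u & 'X_[gap p q] *: u = v.
Proof.
have [b [bdeg bd baug]] := comparison_exists npq I.
have [h [bh0 bhS]] := retraction_homotopic bdeg bd baug.
move=> [z /= zq <-]; have [zT dz] := cocycle_torsion z.
pose y := b i (single p q p (val z)).
have yC : y \in cocycle B I i.
  apply/andP; split; first by apply: torsion_linear; exact: torsion_single.
  rewrite /y bd pullback_map_single dz.
  have -> : single p q p (0 : I i.+1) = 0; last by rewrite linear0.
  by apply: fam_ext => r; rewrite fam_single component0 if_same.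
exists (cls i (Sub y yC)).
  by exists (Sub y yC) => //=; apply: bdeg; exact: gr_single.
rewrite clsZ; apply/eqP; rewrite -subr_eq0; apply/eqP.
rewrite -clsB; apply/cls_boundary; have := retraction_boundary bh0 bhS zT dz.
by rewrite unit_right // -scale_single // linearZ.
Qed.

Lemma localCohomology_gr_scale i (c : k) r u : Hgr i r u -> Hgr i r (c%:MP *: u).
Proof.
move=> [z /= zr <-]; rewrite clsZ; exists (c%:MP *: z) => //=.
exact: gr_scale.
Qed.

Lemma localCohomology_grD i r u v : Hgr i r u -> Hgr i r v -> Hgr i r (u + v).
Proof.
move=> [y /= yr <-] [z /= zr <-]; rewrite -clsD; exists (y + z) => //=.
exact: grD.
Qed.

Lemma localCohomology_gr_monomial i r m u : Hgr i r u -> Hgr i (mnm_degree m + r) ('X_[m] *: u).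
Proof.
move=> [z /= zr <-]; rewrite clsZ; exists ('X_[m] *: z) => //=.
by rewrite -['X_[m]]scale1r; exact: gr_monomial.
Qed.

End Shift.

Lemma neg_max n (p q : 'rV[int]_n) : neg p = neg q ->
  neg (\row_j Num.max (p 0 j) (q 0 j)) = neg p.
Proof.
move=> pq; apply/setP => j; rewrite !inE mxE.
have : (j \in neg p) = (j \in neg q) by rewrite pq.
by rewrite !inE gt_max => <-; rewrite andbb.
Qed.

Theorem theorem1p1 (k : fieldType) (n : nat) (B : set {mpoly k[n]})
    (hB : squarefree_monomial_ideal B)
    (I : injectiveResolution (polynomialModule k n)) (i : nat)
    (p q : 'rV[int]_n) (hpq : neg p = neg q) :
  exists f : localCohomology B I i -> localCohomology B I i,
    [/\ k_isomorphism (localCohomology_gr B I i p)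
                      (localCohomology_gr B I i q) f,
        monomial_shift (localCohomology_gr B I i) p q f &
        forall g : localCohomology B I i -> localCohomology B I i,
          monomial_shift (localCohomology_gr B I i) p q g ->
          forall u, localCohomology_gr B I i p u -> g u = f u].
Proof.
have [G [_ EB]] := hB; move: EB => {hB} ->.
set B' := ideal_generated _; set H := localCohomology B' I i.
set Hgr := localCohomology_gr B' I i.
pose s : 'rV[int]_n := \row_j Num.max (p 0 j) (q 0 j).
have ps : dle p s by move=> j; rewrite mxE le_max lexx.
have qs : dle q s by move=> j; rewrite mxE le_max lexx orbT.
have nps : neg p = neg s by rewrite neg_max.
have nqs : neg q = neg s by rewrite neg_max.
pose a := gap p s; pose b := gap q s.
have HgrB r u v : Hgr r u -> Hgr r v -> Hgr r (u - v).
  move=> ur vr; apply: localCohomology_grD => //.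
  have -> : - v = (- 1 : k)%:MP *: v by rewrite mpolyCN scaleN1r.
  exact: localCohomology_gr_scale.
have cancel r (nrs : neg r = neg s) (rs : dle r s) u v : Hgr r u -> Hgr r v ->
    'X_[gap r s] *: u = 'X_[gap r s] *: v -> u = v.
  move=> ur vr E; apply/eqP; rewrite -subr_eq0; apply/eqP.
  apply: (scale_gap_injective nrs rs (HgrB _ _ _ ur vr)).
  by rewrite scalerBr E subrr.
have to_s r : dle r s -> forall u, Hgr r u -> Hgr s ('X_[gap r s] *: u).
  by move=> rs u ur; rewrite -{1}(gapK rs); exact: localCohomology_gr_monomial.
have ex u : exists v, Hgr p u -> Hgr q v /\ 'X_[b] *: v = 'X_[a] *: u.
  have [up|nup] := EM (Hgr p u); last by exists 0.
  have [v vq E] := scale_gap_surjective nqs qs (to_s _ ps _ up).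
  by exists v.
have [f fP] := choice ex.
have fq u : Hgr p u -> Hgr q (f u) by move=> /fP[].
have fE u : Hgr p u -> 'X_[b] *: f u = 'X_[a] *: u by move=> /fP[].
exists f; split.
- split; last first.
    move=> c u v up vp.
    have cup := localCohomology_gr_scale c up; have uvp := localCohomology_grD cup vp.
    apply: (cancel q nqs qs); first exact: fq.
      by apply: localCohomology_grD; [apply: localCohomology_gr_scale|]; exact: fq.
    rewrite fE // !scalerDr !fE //; congr (_ + _).
    by rewrite !scalerA mulrC [in RHS]mulrC -!scalerA fE.
  split.
  + by move=> u up; exact: fq.
  + move=> u v /[!inE] up vp E.
    by apply: (cancel p nps ps) => //; rewrite -!fE // E.
  move=> v vq; have [u up E] := scale_gap_surjective nps ps (to_s _ qs _ vq).
  exists u => //; apply: (cancel q nqs qs) => //; first exact: fq.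
  by rewrite fE.
- split; first by move=> u up; exact: fq.
  move=> a' b' u E up.
  (* The exponents [a] and [b] have disjoint supports, so any other pair with the
     same difference is a common translate of them. *)
  have [c [-> ->]] : exists c, a' = (c + a)%MM /\ b' = (c + b)%MM.
    have Ej j := congr1 (fun t : 'rV[int]_n => t ord0 j) E.
    exists (a' - a)%MM; split; apply/mnmP => j; rewrite mnmDE mnmBE !mnmE;
      have := Ej j; rewrite !degreeE mxE -[p 0 j]/(p ord0 j) -[q 0 j]/(q ord0 j);
      by case: leP; lia.
  by rewrite !mpolyXD -!scalerA fE.
move=> g [gq gE] u up; apply: (cancel q nqs qs) => //; [exact: gq|exact: fq|].
rewrite fE // -(gE a b) //.
by rewrite addrC gapK // addrC gapK.
Qed.
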